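(* Let $G$ be a matroid on $[n]$ with no loops and no multiple points, and equip $[n]$ with its natural linear order. A subset $S\subseteq[n]$ is an nbb set of $G$ if and only if $S$ is an NBB set in the lattice $\bar{L}(G)$ with respect to this linear order on its atoms.
   Context: $\operatorname{cl}$ is matroid closure; $S$ is line-closed if $\operatorname{cl}(\{i,j\})\subseteq S$ for all $i,j\in S$; $\operatorname{lc}(S)$ is the intersection of line-closed sets containing $S$; $\bar{L}(G)$ is the lattice of line-closed sets ordered by inclusion, with join $X\vee Y=\operatorname{lc}(X\cup Y)$; its atoms are the singletons $\{i\}$, identified with $i\in[n]$. An increasing set $S=\{i_1<\dots<i_p\}$ is nbb if $i_k=\min\operatorname{lc}(\{i_k,\dots,i_p\})$ for each $k$. (Blass–Sagan) For a finite lattice $\bar L$ with a partial order $\preceq$ on its atoms, a set $T$ of atoms is bounded below if there is an atom $a$ with $a<\bigvee T$ and $a\prec t$ for all $t\in T$; a set $S$ of atoms is NBB if it contains no subset $T$ that is bounded below. *)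

(* Defs.v *)
From HB Require Import structures.
From mathcomp Require Import all_boot all_order.
Set Implicit Arguments. Unset Strict Implicit. Unset Printing Implicit Defensive.
Import Order.TTheory.

Record matroid (T : finType) := Matroid {
  indep : pred {set T};
  indep0 : indep set0;
  indepS : forall A B : {set T}, A \subset B -> indep B -> indep A;
  indep_aug : forall A B : {set T}, indep A -> indep B -> #|A| < #|B| ->
    exists2 x, x \in B :\: A & indep (x |: A) }.

Definition rank (T : finType) (G : matroid T) (A : {set T}) : nat :=
  \max_(I : {set T} | (I \subset A) && indep G I) #|I|.

Definition cl (T : finType) (G : matroid T) (A : {set T}) : {set T} :=
  [set x | rank G (x |: A) == rank G A].

Definition loop (T : finType) (G : matroid T) (i : T) : bool :=
  ~~ indep G [set i].

Definition parallel (T : finType) (G : matroid T) (i j : T) : bool :=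
  [&& ~~ loop G i, ~~ loop G j, i != j & ~~ indep G [set i; j]].

Definition loopless (T : finType) (G : matroid T) : Prop :=
  forall i : T, ~~ loop G i.

Definition no_multiple_points (T : finType) (G : matroid T) : Prop :=
  forall i j : T, ~~ parallel G i j.

Definition line_closed (T : finType) (G : matroid T) (S : {set T}) : bool :=
  [forall i in S, forall j in S, cl G [set i; j] \subset S].

Definition lc (T : finType) (G : matroid T) (S : {set T}) : {set T} :=
  \bigcap_(X : {set T} | (S \subset X) && line_closed G X) X.

Lemma line_closedP (T : finType) (G : matroid T) (S : {set T}) :
  reflect (forall i j, i \in S -> j \in S -> cl G [set i; j] \subset S)
          (line_closed G S).
Proof.
apply: (iffP forall_inP) => [H i j iS jS|H i iS].
  by have /forall_inP := H i iS; apply.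
by apply/forall_inP => j jS; apply: H.
Qed.

Lemma line_closedT (T : finType) (G : matroid T) : line_closed G [set: T].
Proof. by apply/line_closedP => i j _ _; apply: subsetT. Qed.

Lemma line_closedI (T : finType) (G : matroid T) (A B : {set T}) :
  line_closed G A -> line_closed G B -> line_closed G (A :&: B).
Proof.
move=> /line_closedP cA /line_closedP cB; apply/line_closedP => i j.
rewrite !inE => /andP[iA iB] /andP[jA jB].
by rewrite subsetI cA ?cB.
Qed.

Lemma lc_closed (T : finType) (G : matroid T) (S : {set T}) :
  line_closed G (lc G S).
Proof.
rewrite /lc; elim/big_ind: _ => [||X /andP[]//]; first exact: line_closedT.
exact: line_closedI.
Qed.

Lemma sub_lc (T : finType) (G : matroid T) (S : {set T}) : S \subset lc G S.
Proof. by apply/bigcapsP => X /andP[]. Qed.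

Lemma lc_min (T : finType) (G : matroid T) (S X : {set T}) :
  S \subset X -> line_closed G X -> lc G S \subset X.
Proof. by move=> SX cX; apply: bigcap_inf; rewrite SX. Qed.

Lemma lc_sub (T : finType) (G : matroid T) (S X : {set T}) :
  line_closed G X -> (lc G S \subset X) = (S \subset X).
Proof.
move=> cX; apply/idP/idP => [|SX]; last exact: lc_min.
exact/subset_trans/sub_lc.
Qed.

Definition is_min (n : nat) (i : 'I_n) (A : {set 'I_n}) : bool :=
  (i \in A) && [forall j in A, i <= j].

(* When S = {i_1 < ... < i_p}, the elements of S that are >= i_k are exactly
   i_k, ..., i_p. *)
Definition nbb (n : nat) (G : matroid 'I_n) (S : {set 'I_n}) : bool :=
  [forall i in S, is_min i (lc G [set j in S | i <= j])].

Record lcset (T : finType) (G : matroid T) := Lcset {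
  lcset_val :> {set T};
  lcset_closed : line_closed G lcset_val }.

HB.instance Definition _ (T : finType) (G : matroid T) :=
  [isSub for @lcset_val T G].
HB.instance Definition _ (T : finType) (G : matroid T) :=
  [Finite of lcset G by <:].

Definition lcspan (T : finType) (G : matroid T) (A : {set T}) : lcset G :=
  Lcset (lc_closed G A).

Fact lcset_display : Order.disp_t. Proof. exact: Order.Disp tt tt. Qed.

Definition lcset_le (T : finType) (G : matroid T) (X Y : lcset G) : bool :=
  lcset_val X \subset lcset_val Y.

Definition lcset_meet (T : finType) (G : matroid T) (X Y : lcset G) : lcset G :=
  Lcset (line_closedI (lcset_closed X) (lcset_closed Y)).

Definition lcset_join (T : finType) (G : matroid T) (X Y : lcset G) : lcset G :=
  lcspan G (lcset_val X :|: lcset_val Y).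

Lemma lcset_le_refl (T : finType) (G : matroid T) : reflexive (@lcset_le T G).
Proof. by move=> X; apply: subxx. Qed.

Lemma lcset_le_anti (T : finType) (G : matroid T) :
  antisymmetric (@lcset_le T G).
Proof. by move=> X Y XY; apply/val_inj/eqP; rewrite eqEsubset. Qed.

Lemma lcset_le_trans (T : finType) (G : matroid T) : transitive (@lcset_le T G).
Proof. by move=> Y X Z; apply: subset_trans. Qed.

HB.instance Definition _ (T : finType) (G : matroid T) :=
  Order.Le_isPOrder.Build lcset_display (lcset G)
    (@lcset_le_refl T G) (@lcset_le_anti T G) (@lcset_le_trans T G).

Lemma lcset_leE (T : finType) (G : matroid T) (X Y : lcset G) :
  (X <= Y)%O = (lcset_val X \subset lcset_val Y).
Proof. by []. Qed.

Lemma lcset_meetP (T : finType) (G : matroid T) (X Y Z : lcset G) :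
  (X <= lcset_meet Y Z)%O = (X <= Y)%O && (X <= Z)%O.
Proof. by rewrite !lcset_leE subsetI. Qed.

Lemma lcset_joinP (T : finType) (G : matroid T) (X Y Z : lcset G) :
  (lcset_join X Y <= Z)%O = (X <= Z)%O && (Y <= Z)%O.
Proof. by rewrite !lcset_leE /= lc_sub ?lcset_closed// subUset. Qed.

HB.instance Definition _ (T : finType) (G : matroid T) :=
  Order.POrder_MeetJoin_isLattice.Build lcset_display (lcset G)
    (@lcset_meetP T G) (@lcset_joinP T G).

Lemma lcset_le0x (T : finType) (G : matroid T) (X : lcset G) :
  (lcspan G set0 <= X)%O.
Proof. by rewrite lcset_leE /= lc_sub ?lcset_closed// sub0set. Qed.

Lemma lcset_lex1 (T : finType) (G : matroid T) (X : lcset G) :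
  (X <= lcspan G [set: T])%O.
Proof. by rewrite lcset_leE; apply/(subset_trans _ (sub_lc _ _))/subsetT. Qed.

HB.instance Definition _ (T : finType) (G : matroid T) :=
  Order.hasBottom.Build lcset_display (lcset G) (@lcset_le0x T G).
HB.instance Definition _ (T : finType) (G : matroid T) :=
  Order.hasTop.Build lcset_display (lcset G) (@lcset_lex1 T G).

Definition Lbar (T : finType) (G : matroid T) : finTBLatticeType lcset_display :=
  lcset G.

Definition atom (d : Order.disp_t) (L : finTBLatticeType d) : pred L :=
  fun a => (\bot < a)%O && [forall x : L, (x < a)%O ==> (x == \bot%O)].

Record atom_order (d : Order.disp_t) (L : finTBLatticeType d) := AtomOrder {
  atom_le :> rel L;
  atom_le_refl : forall a, atom a -> atom_le a a;
  atom_le_anti : forall a b, atom a -> atom b ->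
    atom_le a b -> atom_le b a -> a = b;
  atom_le_trans : forall a b c, atom a -> atom b -> atom c ->
    atom_le a b -> atom_le b c -> atom_le a c }.

Definition atom_lt (d : Order.disp_t) (L : finTBLatticeType d)
  (le : atom_order L) (a b : L) : bool := (a != b) && le a b.

Definition bounded_below (d : Order.disp_t) (L : finTBLatticeType d)
    (le : atom_order L) (T : {set L}) : bool :=
  [exists a : L, [&& atom a, (a < \join_(t in T) t)%O
                   & [forall t in T, atom_lt le a t]]].

Definition NBB (d : Order.disp_t) (L : finTBLatticeType d)
    (le : atom_order L) (S : {set L}) : bool :=
  [forall a in S, atom a] &&
  [forall T : {set L}, (T \subset S) ==> ~~ bounded_below le T].

(* The atom of Lbar G identified with the point i.  In general lc {i} may be
   larger than {i}, but it is {i} for the matroids considered (pt_val). *)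
Definition pt (T : finType) (G : matroid T) (i : T) : Lbar G :=
  lcspan G [set i].

Lemma rank_indep (T : finType) (G : matroid T) (A : {set T}) :
  indep G A -> rank G A = #|A|.
Proof.
move=> iA; apply/eqP; rewrite eqn_leq; apply/andP; split.
  by apply/bigmax_leqP => I /andP[IA _]; apply: subset_leq_card.
by apply: (@leq_bigmax_cond _ _ (fun I : {set T} => #|I|)); rewrite subxx.
Qed.

Lemma line_closed1 (T : finType) (G : matroid T) (i : T) :
  loopless G -> no_multiple_points G -> line_closed G [set i].
Proof.
move=> nl nm; apply/line_closedP => a b /set1P-> /set1P->; rewrite setUid.
apply/subsetP => x; rewrite !inE; apply: contraTT => xi.
have ixi : indep G [set x; i].
  by have := nm x i; rewrite /parallel !nl xi /= negbK.
have := nl i; rewrite /loop negbK => ii.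
by rewrite (rank_indep ixi) (rank_indep ii) cards2 xi cards1.
Qed.

Lemma line_closed0 (T : finType) (G : matroid T) : line_closed G set0.
Proof. by apply/line_closedP => i j; rewrite inE. Qed.

Lemma Lbar_bot (T : finType) (G : matroid T) :
  lcset_val (\bot%O : Lbar G) = set0.
Proof. by apply/eqP; rewrite -subset0 lc_min ?line_closed0. Qed.

Lemma pt_val (T : finType) (G : matroid T) (i : T) :
  loopless G -> no_multiple_points G -> lcset_val (pt G i) = [set i].
Proof.
move=> nl nm; apply/eqP.
by rewrite eqEsubset sub_lc lc_min ?line_closed1.
Qed.

Lemma pt_inj (T : finType) (G : matroid T) :
  loopless G -> no_multiple_points G -> injective (pt G).
Proof.
move=> nl nm i j /(congr1 (@lcset_val T G)).
by rewrite !pt_val// => /set1_inj.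
Qed.

Lemma Lbar_atomP (T : finType) (G : matroid T) (X : Lbar G) :
  loopless G -> no_multiple_points G ->
  reflect (exists i, X = pt G i) (atom X).
Proof.
move=> nl nm; apply: (iffP idP) => [/andP[X0 /forallP Xmin]|[i ->]].
  have [X_0|[i iX]] := set_0Vmem (lcset_val X).
    move: X0; rewrite lt_neqAle => /andP[/eqP[]].
    by apply: val_inj; rewrite /= X_0; apply: Lbar_bot.
  exists i; have piX : (pt G i <= X)%O by rewrite lcset_leE pt_val// sub1set.
  move: piX; rewrite le_eqVlt => /predU1P[//|piX].
  have := Xmin (pt G i); rewrite piX /= => /eqP pi0.
  by have := Lbar_bot G; rewrite -pi0 pt_val// => /setP/(_ i); rewrite !inE eqxx.
apply/andP; split.
  rewrite lt_neqAle le0x andbT; apply/eqP => /(congr1 (@lcset_val T G)).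
  by rewrite Lbar_bot pt_val// => /setP/(_ i); rewrite !inE eqxx.
apply/forallP => Y; apply/implyP; rewrite lt_neqAle => /andP[Yi].
rewrite lcset_leE pt_val// subset1 => /orP[] /eqP Y_eq.
  by case/eqP: Yi; apply: val_inj; rewrite [LHS]Y_eq; symmetry; apply: pt_val.
by apply/eqP/val_inj; rewrite [LHS]Y_eq; symmetry; apply: Lbar_bot.
Qed.

Definition pt_le (n : nat) (G : matroid 'I_n) : rel (Lbar G) :=
  fun a b => [exists i : 'I_n, exists j : 'I_n,
               [&& a == pt G i, b == pt G j & i <= j]].

Lemma pt_leE (n : nat) (G : matroid 'I_n) :
  loopless G -> no_multiple_points G ->
  forall i j, pt_le (pt G i) (pt G j) = (i <= j).
Proof.
move=> nl nm i j; apply/existsP/idP => [[i' /existsP[j']]|ij].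
  by case/and3P => /eqP/(pt_inj nl nm)-> /eqP/(pt_inj nl nm)->.
by exists i; apply/existsP; exists j; rewrite !eqxx.
Qed.

Lemma pt_le_refl (n : nat) (G : matroid 'I_n) :
  loopless G -> no_multiple_points G ->
  forall a : Lbar G, atom a -> pt_le a a.
Proof. by move=> nl nm a /(Lbar_atomP _ nl nm)[i ->]; rewrite pt_leE. Qed.

Lemma pt_le_anti (n : nat) (G : matroid 'I_n) :
  loopless G -> no_multiple_points G ->
  forall a b : Lbar G, atom a -> atom b -> pt_le a b -> pt_le b a -> a = b.
Proof.
move=> nl nm a b /(Lbar_atomP _ nl nm)[i ->] /(Lbar_atomP _ nl nm)[j ->].
rewrite !pt_leE// => ij ji; congr pt; apply/val_inj/eqP.
by rewrite eqn_leq ij.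
Qed.

Lemma pt_le_trans (n : nat) (G : matroid 'I_n) :
  loopless G -> no_multiple_points G ->
  forall a b c : Lbar G, atom a -> atom b -> atom c ->
    pt_le a b -> pt_le b c -> pt_le a c.
Proof.
move=> nl nm a b c /(Lbar_atomP _ nl nm)[i ->] /(Lbar_atomP _ nl nm)[j ->].
by move=> /(Lbar_atomP _ nl nm)[k ->]; rewrite !pt_leE//; apply: leq_trans.
Qed.

Definition natural_order (n : nat) (G : matroid 'I_n)
    (nl : loopless G) (nm : no_multiple_points G) : atom_order (Lbar G) :=
  AtomOrder (pt_le_refl nl nm) (pt_le_anti nl nm) (pt_le_trans nl nm).

(* Main.v *)
Require Import Defs.
From mathcomp Require Import all_boot all_order.
Set Implicit Arguments. Unset Strict Implicit. Unset Printing Implicit Defensive.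
Import Order.TTheory.

(* Both conditions say that no subset U of S admits a point a in lc U smaller
   than every element of U. For nbb one only tests final segments of S, but
   this suffices: U is contained in the final segment starting at min U. *)

Lemma lc_mono (T : finType) (G : matroid T) (A B : {set T}) :
  A \subset B -> lc G A \subset lc G B.
Proof. by move=> AB; rewrite lc_sub ?lc_closed// (subset_trans AB) ?sub_lc. Qed.

(** This disposes of the empty set of atoms: every point is vacuously smaller than all its elements,
    but none lies in its line closure. *)
Lemma lc0 (T : finType) (G : matroid T) : lc G set0 = set0.
Proof. by apply/eqP; rewrite -subset0 lc_min ?line_closed0. Qed.

(** Both sides are the least line-closed set containing [A]. This turns the lattice condition of
    [bounded_below] into one about [lc]. *)
Lemma join_pt (T : finType) (G : matroid T) (A : {set T}) :
  (\join_(X in [set pt G i | i in A]) X)%O = lcspan G A :> Lbar G.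
Proof.
apply/eqP; rewrite eq_le; apply/andP; split.
  apply/joinsP => _ /imsetP[i iA ->].
  by rewrite lcset_leE lc_mono// sub1set.
rewrite lcset_leE lc_sub ?lcset_closed//; apply/subsetP => i iA.
have: (pt G i <= \join_(X in [set pt G j | j in A]) X)%O.
  by apply: (@joins_sup _ _ _ (pt G i) _ id); apply: imset_f.
by rewrite lcset_leE => /subsetP; apply; rewrite (subsetP (sub_lc _ _))// inE.
Qed.

(** Strictness in $a < \bigvee T$ comes for free: a point of [lc G A] smaller than all of [A] cannot
    be the whole of [lc G A]. *)
Lemma bounded_below_ptP (n : nat) (G : matroid 'I_n)
    (nl : loopless G) (nm : no_multiple_points G) (A : {set 'I_n}) :
  reflect (exists2 a : 'I_n, a \in lc G A & forall i, i \in A -> a < i)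
          (bounded_below (natural_order nl nm) [set pt G i | i in A]).
Proof.
have ptlt a i : atom_lt (natural_order nl nm) (pt G a) (pt G i) = (a < i).
  by rewrite /atom_lt /= pt_leE// (inj_eq (pt_inj nl nm)) ltn_neqAle.
apply: (iffP existsP) => [[X]|[a aA aP]].
  case/and3P => /(Lbar_atomP _ nl nm)[a ->] /ltW; rewrite join_pt lcset_leE.
  rewrite pt_val// sub1set => aA /forall_inP aP; exists a => // i iA.
  by rewrite -ptlt aP ?imset_f.
exists (pt G a); apply/and3P; split.
- by apply/(Lbar_atomP _ nl nm); exists a.
- rewrite join_pt lt_neqAle lcset_leE pt_val// sub1set aA andbT.
  (* If [lc G A] were [[set a]], any element of [A] would equal [a], contradicting [a < i]; so [A]
     would be empty, and [lc G A] too. *)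
  apply/eqP => /(congr1 (@lcset_val _ G)); rewrite pt_val//= => eqA.
  have AE : A = set0.
    apply/setP => i; rewrite inE; apply/negP => iA.
    have := subsetP (sub_lc G A) i iA; rewrite -eqA inE => /eqP ia.
    by have := aP i iA; rewrite ia ltnn.
  by move: aA; rewrite AE lc0 inE.
- by apply/forall_inP => _ /imsetP[i iA ->]; rewrite ptlt aP.
Qed.

Lemma NBB_ptP (n : nat) (G : matroid 'I_n)
    (nl : loopless G) (nm : no_multiple_points G) (S : {set 'I_n}) :
  reflect (forall A : {set 'I_n}, A \subset S ->
             forall a, a \in lc G A -> exists2 i, i \in A & i <= a)
          (NBB (natural_order nl nm) [set pt G i | i in S]).
Proof.
apply: (iffP andP) => [[_ /forallP SP] A AS a aA|SP].
  apply/exists_inP; apply: contraT; rewrite negb_exists_in => /forall_inP aP.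
  have /implyP/(_ (imsetS _ AS))/negP[] := SP [set pt G i | i in A].
  by apply/bounded_below_ptP; exists a => // i /aP; rewrite -ltnNge.
split.
  by apply/forall_inP => _ /imsetP[i _ ->]; apply/(Lbar_atomP _ nl nm); exists i.
apply/forallP => X; apply/implyP => /subsetP XS.
(* A set of atoms taken from the image of [S] is the image of its preimage in [S], so
   [bounded_below_ptP] applies. *)
have -> : X = [set pt G i | i in [set i in S | pt G i \in X]].
  apply/setP => Y; apply/idP/imsetP => [YX|[i + ->]].
    by have /imsetP[i iS YE] := XS Y YX; exists i; rewrite // inE iS -YE.
  by rewrite inE => /andP[].
apply/bounded_below_ptP => -[a aA aP].
have [|i iA] := SP _ _ a aA; last by rewrite leqNgt aP.
by apply/subsetP => i; rewrite inE => /andP[].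
Qed.

Theorem theorem2p28 (n : nat) (G : matroid 'I_n)
    (nl : loopless G) (nm : no_multiple_points G) (S : {set 'I_n}) :
  nbb G S <-> NBB (natural_order nl nm) [set pt G i | i in S].
Proof.
split => [/forall_inP Snbb|/NBB_ptP SP].
  apply/NBB_ptP => A AS a aA.
  have [A0|[i0 i0A]] := set_0Vmem A; first by move: aA; rewrite A0 lc0 inE.
  (* With [m] the minimum of [A], monotonicity of [lc] puts [a] in the closure of the final segment
     of [S] at [m], whose minimum is [m]. *)
  have [m mA mmin] := arg_minnP (fun i : 'I_n => i : nat) i0A.
  exists m => //; have /andP[_ /forall_inP] := Snbb m (subsetP AS m mA).
  apply; apply: (subsetP _ _ aA); apply: lc_mono; apply/subsetP => i iA.
  by rewrite inE (subsetP AS)// mmin.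
apply/forall_inP => i iS; apply/andP; split.
  by apply: (subsetP (sub_lc _ _)); rewrite inE iS leqnn.
apply/forall_inP => a aA.
(* Here the subset is the final segment itself: it has an element [j] with [i <= j <= a]. *)
have [|j] := SP _ _ a aA; first by apply/subsetP => j; rewrite inE => /andP[].
by rewrite inE => /andP[_ ij] /(leq_trans ij).
Qed.
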